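(* Let $A,B,G$ be three groups and $\varphi : G \to A \wr B$ a morphism. If $G$ is finitely presented and satisfies the property $(\mathrm{FW}_{\mathrm{fin}})$, then $\varphi(G)$ has a finite projection on $B$ or it lies in a conjugate of $B$.
   Context: $A \wr B := \bigoplus_B A \rtimes B$ is the restricted wreath product, $B$ acting on $\bigoplus_B A$ by permuting the coordinates through left multiplication on $B$; the projection on $B$ is the quotient map with kernel $\bigoplus_B A$. A group satisfies the property $(\mathrm{FW}_{\mathrm{fin}})$ if it cannot act on a finite-dimensional CAT(0) cube complex with unbounded orbits (equivalently, without a global fixed point). *)

(* Defs.v *)
From HB Require Import structures.
From mathcomp Require Import all_boot finmap.
From mathcomp Require Import boolp classical_sets cardinality.

Set Implicit Arguments.
Unset Strict Implicit.
Unset Printing Implicit Defensive.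

Local Open Scope classical_set_scope.
Local Open Scope group_scope.

(** * Restricted wreath products *)

Section Wreath.
Variables A B : groupType.

Record wreath := Wreath {
  lamps : {fsfun B -> A with 1};
  cursor : B
}.

Definition pair_of_wreath (u : wreath) := (lamps u, cursor u).
Definition wreath_of_pair p := Wreath p.1 p.2.

Lemma pair_of_wreathK : cancel pair_of_wreath wreath_of_pair.
Proof. by case. Qed.

HB.instance Definition _ := Choice.copy wreath (can_type pair_of_wreathK).

Lemma wreath_eqP (u v : wreath) :
  lamps u =1 lamps v -> cursor u = cursor v -> u = v.
Proof. by case: u v => [f b] [g c] /= /fsfunP -> ->. Qed.

Definition wreath_one : wreath := Wreath [fsfun] 1.

(* [b] sends the coordinate of index [x] to the index [b * x]: the value of
   [b . f] at [x] is [f (b^-1 * x)]. *)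
Definition wreath_mul (u v : wreath) : wreath :=
  Wreath
    [fsfun x in (finsupp (lamps u) `|`
                 [fset cursor u * y | y in finsupp (lamps v)])%fset
       => lamps u x * lamps v ((cursor u)^-1 * x)]
    (cursor u * cursor v).

Definition wreath_inv (u : wreath) : wreath :=
  Wreath
    [fsfun x in [fset (cursor u)^-1 * y | y in finsupp (lamps u)]%fset
       => (lamps u (cursor u * x))^-1]
    (cursor u)^-1.

Lemma lamps_one x : lamps wreath_one x = 1.
Proof. by rewrite fsfun0E. Qed.

Lemma lamps_mul u v x :
  lamps (wreath_mul u v) x = lamps u x * lamps v ((cursor u)^-1 * x).
Proof.
rewrite fsfun_fun inE; case: finsuppP => //= xNu.
case: ifPn => // xNv; rewrite mul1g fsfun_dflt //.
apply: contraNN xNv => xv; apply/imfsetP => /=.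
by exists ((cursor u)^-1 * x); rewrite ?mulVKg.
Qed.

Lemma lamps_inv u x : lamps (wreath_inv u) x = (lamps u (cursor u * x))^-1.
Proof.
rewrite fsfun_fun; case: ifPn => // xNu; rewrite fsfun_dflt ?invg1 //.
apply: contraNN xNu => xu; apply/imfsetP => /=.
by exists (cursor u * x); rewrite ?mulKg.
Qed.

Lemma wreath_mulA : associative wreath_mul.
Proof.
move=> u v w; apply: wreath_eqP => [x|]; last exact: mulgA.
by rewrite !lamps_mul mulgA invgM mulgA.
Qed.

Lemma wreath_mul1 : left_id wreath_one wreath_mul.
Proof.
move=> u; apply: wreath_eqP => [x|]; last exact: mul1g.
by rewrite lamps_mul lamps_one invg1 !mul1g.
Qed.

Lemma wreath_mulr1 : right_id wreath_one wreath_mul.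
Proof.
move=> u; apply: wreath_eqP => [x|]; last exact: mulg1.
by rewrite lamps_mul lamps_one mulg1.
Qed.

Lemma wreath_mulV : left_inverse wreath_one wreath_inv wreath_mul.
Proof.
move=> u; apply: wreath_eqP => [x|]; last exact: mulVg.
by rewrite lamps_mul lamps_inv invgK mulVg lamps_one.
Qed.

Lemma wreath_mulgV : right_inverse wreath_one wreath_inv wreath_mul.
Proof.
move=> u; apply: wreath_eqP => [x|]; last exact: mulgV.
by rewrite lamps_mul lamps_inv mulVKg mulgV lamps_one.
Qed.

HB.instance Definition _ := isGroup.Build wreath
  wreath_mulA wreath_mul1 wreath_mulr1 wreath_mulV wreath_mulgV.

Definition wreath_base (b : B) : wreath := Wreath [fsfun] b.

End Wreath.

(** * Finitely presented groups *)

(* [(i, false)] is the generator of index [i], [(i, true)] its inverse. *)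
Definition word n := seq ('I_n * bool).

Definition letter_eval (G : groupType) n (gen : 'I_n -> G) (l : 'I_n * bool) :=
  if l.2 then (gen l.1)^-1 else gen l.1.

Definition word_eval (G : groupType) n (gen : 'I_n -> G) (w : word n) : G :=
  \prod_(l <- w) letter_eval gen l.

(* Equality in the group presented by the generators ['I_n] and the
   relators [rels]. *)
Inductive word_equiv n (rels : seq (word n)) : word n -> word n -> Prop :=
| word_refl w : word_equiv rels w w
| word_sym w w' : word_equiv rels w w' -> word_equiv rels w' w
| word_trans w w' w'' :
    word_equiv rels w w' -> word_equiv rels w' w'' -> word_equiv rels w w''
| word_cancel w w' i e :
    word_equiv rels (w ++ [:: (i, e); (i, ~~ e)] ++ w') (w ++ w')
| word_relator w w' r :
    r \in rels -> word_equiv rels (w ++ r ++ w') (w ++ w').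

Definition finitely_presented (G : groupType) : Prop :=
  exists n (gen : 'I_n -> G) (rels : seq (word n)),
    (forall g, exists w, word_eval gen w = g) /\
    (forall w w', word_eval gen w = word_eval gen w' <-> word_equiv rels w w').

(** * Cube complexes *)

(* The vertices of the n-cube are the functions ['I_n -> bool]; a face is
   given by fixing some of the coordinates. *)
Definition cube_face n (p : 'I_n -> option bool) : set {ffun 'I_n -> bool} :=
  [set x | forall i e, p i = Some e -> x i = e].

(* [c] identifies the n-cube with the vertex set [s], the faces of the n-cube
   corresponding to the members of [cube] contained in [s]. *)
Definition cube_chart V (cube : set (set V)) n
    (c : {ffun 'I_n -> bool} -> V) (s : set V) : Prop :=
  [/\ injective c,
      s = range c
    & forall t, t `<=` s -> (cube t <-> exists p, t = c @` cube_face p)].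

(* Cubes are embedded and two cubes meet in a common face or not at all, as in
   Bridson and Haefliger's definition of a cubed complex, so that a cube is
   identified with the set of its vertices. Nothing is lost for CAT(0) cube
   complexes, where both conditions always hold. *)
Record cubeComplex := CubeComplex {
  vertex :> Type;
  cube : set (set vertex);
  cube_vertex : forall v, cube [set v];
  cubeP : forall s, cube s ->
    exists n (c : {ffun 'I_n -> bool} -> vertex), cube_chart cube c s;
  cubeI : forall s t, cube s -> cube t -> s `&` t !=set0 -> cube (s `&` t)
}.

Section CubeComplex.
Variable X : cubeComplex.
Implicit Types (v w : X) (s t : set X).

Definition finite_dimensional : Prop :=
  exists d, forall n (c : {ffun 'I_n -> bool} -> X) s,
    cube s -> cube_chart (@cube X) c s -> n <= d.

Definition adjacent v w : Prop := v <> w /\ cube [set v; w].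

(* The 2-cube with boundary the 4-cycle v1, v2, v3, v4. *)
Definition square v1 v2 v3 v4 : Prop :=
  [/\ [/\ adjacent v1 v2, adjacent v2 v3, adjacent v3 v4 & adjacent v4 v1],
      v1 <> v3, v2 <> v4
    & cube [set v | [\/ v = v1, v = v2, v = v3 | v = v4]]].

(* The edge path visits [v] and then the successive elements of [p]; it ends
   at [last v p] and its length is [size p]. *)
Fixpoint edge_path v (p : seq X) : Prop :=
  if p is w :: q then adjacent v w /\ edge_path w q else True.

(* Homotopy with fixed endpoints of edge paths, given as lists of vertices. *)
Inductive edge_homotopic : seq X -> seq X -> Prop :=
| edge_homotopic_refl p : edge_homotopic p p
| edge_homotopic_sym p q : edge_homotopic p q -> edge_homotopic q p
| edge_homotopic_trans p q r :
    edge_homotopic p q -> edge_homotopic q r -> edge_homotopic p r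
| edge_homotopic_backtrack p q v w : adjacent v w ->
    edge_homotopic (p ++ [:: v; w; v] ++ q) (p ++ [:: v] ++ q)
| edge_homotopic_square p q v1 v2 v3 v4 : square v1 v2 v3 v4 ->
    edge_homotopic (p ++ [:: v1; v2; v3] ++ q) (p ++ [:: v1; v4; v3] ++ q).

Definition simply_connected : Prop :=
  [/\ inhabited X,
      forall v w, exists2 p, edge_path v p & last v p = w
    & forall v p, edge_path v p -> last v p = v ->
        edge_homotopic (v :: p) [:: v]].

(* The vertices of the link of [v] are the edges at [v], identified with the
   neighbours of [v]; each cube containing [v] contributes the simplex spanned
   by its edges at [v]. *)
Definition link_simplex v s : Prop :=
  exists2 t, cube t & t v /\ s = [set w | t w /\ adjacent v w].

(* The case [w = w'] says that the elements of [s] are vertices of the link. *)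
Definition flag_link v : Prop :=
  forall s, finite_set s ->
    (forall w w', s w -> s w' -> link_simplex v [set w; w']) ->
    link_simplex v s.

Definition CAT0 : Prop := simply_connected /\ forall v, flag_link v.

End CubeComplex.

Record cube_action (G : groupType) (X : cubeComplex) := CubeAction {
  act :> G -> X -> X;
  act1 : forall v, act 1 v = v;
  actM : forall g h v, act (g * h) v = act g (act h v);
  act_cube : forall g s, cube s -> cube (act g @` s)
}.

(* Boundedness refers to the graph metric of the 1-skeleton, which is
   equivalent to the CAT(0) metric for this purpose in finite dimension. *)
Definition bounded_orbit (G : groupType) (X : cubeComplex)
    (a : cube_action G X) (v : X) : Prop :=
  exists N, forall g, exists p : seq X,
    [/\ edge_path v p, last v p = a g v & size p <= N].

Definition FW_fin (G : groupType) : Prop :=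
  ~ exists (X : cubeComplex) (a : cube_action G X) (v : X),
      [/\ finite_dimensional X, CAT0 X & ~ bounded_orbit a v].

(* Main.v *)
Require Import Defs.
From HB Require Import structures.
From mathcomp Require Import all_boot generic_quotient finmap.
From mathcomp Require Import boolp classical_sets cardinality.

(** The wreath product acts on Z = B * A, the pairs made of a site x and a
possible state a of the lamp at x, by (x, a) |-> (b x, f (b x) a) where f is
the lamp configuration and b the cursor. The set M of the pairs (x, 1) is the
graph of the trivial configuration, and for g in G the symmetric difference
of M and gM has two points for each lamp that [phi g] modifies. The proof
shows that these symmetric differences have bounded cardinality, and then
that this forces the conclusion.

Boundedness. Let Gamma be a graph with vertex set Z which G preserves and
whose cliques have bounded size. The right-angled Coxeter group W of Gamma
(one involution per element of Z, commuting for adjacent elements) acts on its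
Davis complex, the vertices of which are the elements of W and the cubes of
which are the cosets of the subgroups generated by the cliques. This is a
finite-dimensional CAT(0) cube complex ([davis_CAT0],
[davis_finite_dimensional]). Since G also acts on W by automorphisms, any
cocycle G -> W yields an action of G on the complex, and FW_fin bounds the
number of letters of odd multiplicity in the values of the cocycle
([FW_fin_bounded_cocycle]). When Gamma joins any two pairs with distinct
sites, such a cocycle is given by the product over the sites x of the words
(x, 1) (x, f x), f being the lamps of [phi g]: at each site it records a path
from the state 1 to the state f x, and such paths compose. Its odd letters
form the symmetric difference of M and gM. This Gamma has unbounded cliques,
but a relation between words involves finitely many commutations. As G is
finitely presented, the cocycle therefore survives when only the pairs whose
sites differ by an element of a suitable finite subset S of B are joined, and
then the cliques are bounded ([lamp_cocycle], [near_clique]).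

Conclusion. When a group acts on a set with the symmetric differences of M and
gM bounded, an invariant set M' has a finite symmetric difference with M
([almost_invariant]). The sites over which M' is not the graph of a function
form a finite subset of B that is invariant under the projection of G. If it
is not empty, the projection is finite because B acts freely on itself.
Otherwise M' is the graph of a configuration c of finite support fixed by G,
and [phi] takes its values in the conjugate of B by c ([fixed_or_finite]). *)

Set Implicit Arguments.
Unset Strict Implicit.
Unset Printing Implicit Defensive.

Local Open Scope classical_set_scope.
Local Open Scope group_scope.

(** * Words in a right-angled Coxeter group *)
Section RightAngledCoxeterGroup.
Variables (Z : choiceType) (com : rel Z).
Implicit Types (x y z : Z) (u v w L : seq Z).

(** Words represent the same element of the right-angled Coxeter group when
they are related by these moves. They are also the elementary homotopies of
edge paths in the Davis complex, backtracks and squares, which makes that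
complex simply connected by construction. *)
Inductive weq : seq Z -> seq Z -> Prop :=
| weq_refl u : weq u u
| weq_sym u v : weq u v -> weq v u
| weq_trans u v w : weq u v -> weq v w -> weq u w
| weq_cancel u v z : weq (u ++ [:: z; z] ++ v) (u ++ v)
| weq_swap u v y z : com y z ->
    weq (u ++ [:: y; z] ++ v) (u ++ [:: z; y] ++ v).

Lemma weq_cat u u' v v' : weq u u' -> weq v v' -> weq (u ++ v) (u' ++ v').
Proof.
move=> uu' vv'; apply: (@weq_trans _ (u' ++ v)).
  elim: uu' => {u u'} [u|u u' _|u u' u'' _ + _|u u' z|u u' y z yz].
  - exact: weq_refl.
  - exact: weq_sym.
  - exact: weq_trans.
  - by rewrite -!catA; apply: weq_cancel.
  - by rewrite -!catA; apply: weq_swap.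
elim: vv' => {v v'} [v|v v' _|v v' v'' _ + _|v v' z|v v' y z yz].
- exact: weq_refl.
- exact: weq_sym.
- exact: weq_trans.
- by rewrite !(catA u'); apply: weq_cancel.
- by rewrite !(catA u'); apply: weq_swap.
Qed.

Lemma weq_catl u v v' : weq v v' -> weq (u ++ v) (u ++ v').
Proof. exact/weq_cat/weq_refl. Qed.

Lemma weq_catr u u' v : weq u u' -> weq (u ++ v) (u' ++ v).
Proof. by move/weq_cat; apply; apply: weq_refl. Qed.

Lemma weq_revK u : weq (rev u ++ u) [::].
Proof.
elim: u => [|z u IHu]; first exact: weq_refl.
rewrite rev_cons cat_rcons; apply: weq_trans IHu.
exact: (weq_cancel (rev u) u z).
Qed.

Lemma weq_catrevK u : weq (u ++ rev u) [::].
Proof. by have := weq_revK (rev u); rewrite revK. Qed.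

Lemma weq_cancell u v w : weq (u ++ v) (u ++ w) -> weq v w.
Proof.
have K v' : weq (rev u ++ u ++ v') v'.
  by rewrite catA; apply: (weq_catr v' (weq_revK u)).
move=> /(weq_catl (rev u)) uvw.
exact: weq_trans (weq_sym (K v)) (weq_trans uvw (K w)).
Qed.

Lemma weq_revP u v : weq (u ++ rev v) [::] -> weq u v.
Proof.
move=> uv0; have := weq_catr v uv0; rewrite -catA; apply: weq_trans.
by have := weq_catl u (weq_sym (weq_revK v)); rewrite cats0.
Qed.

Lemma weq_push z u : {in u, forall y, com z y} -> weq (z :: u) (rcons u z).
Proof.
elim: u => [|y u IHu] zu /=; first exact: weq_refl.
apply: (@weq_trans _ (y :: z :: u)).
  by apply: (weq_swap [::] u); apply: zu; rewrite mem_head.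
by apply: (weq_catl [:: y]); apply: IHu => t tu; apply: zu; rewrite inE tu orbT.
Qed.

(** The abelianization of the group, a sum of copies of Z/2. Each injectivity
statement below is read off from it. *)
Definition parity u z : bool := odd (count_mem z u).

Lemma parity_cat u v z : parity (u ++ v) z = parity u z (+) parity v z.
Proof. by rewrite /parity count_cat oddD. Qed.

Lemma parity_rev u : parity (rev u) =1 parity u.
Proof. by move=> z; rewrite /parity count_rev. Qed.

Lemma parity_mem u z : parity u z -> z \in u.
Proof. by rewrite /parity -has_pred1 has_count; case: count. Qed.

Lemma parity1 y z : parity [:: y] z = (y == z).
Proof. by rewrite /parity /= addn0; case: eqP. Qed.

Lemma parity_cons y u z : parity (y :: u) z = (y == z) (+) parity u z.
Proof. by rewrite -cat1s parity_cat parity1. Qed.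

Lemma parity_uniq u z : uniq u -> parity u z = (z \in u).
Proof.
by move=> u_uniq; rewrite /parity count_uniq_mem //; case: (z \in u).
Qed.

Lemma weq_parity u v : weq u v -> parity u =1 parity v.
Proof.
elim=> {u v} [u|u v _ uv|u v w _ uv _ vw|u v z|u v y z _] t //.
- by rewrite uv vw.
- by rewrite !parity_cat parity_cons parity1 addbb.
- by rewrite !parity_cat !parity_cons; congr addb; rewrite addbCA.
Qed.

Definition clique L : Prop := {in L &, forall y z, y != z -> com y z}.

Lemma clique_sub L L' : {subset L' <= L} -> clique L -> clique L'.
Proof. by move=> sLL' LP y z /sLL' yL /sLL'; apply: LP. Qed.

(** The first letter of a word of trivial parity occurs a second time; it can
be pushed through the word to that occurrence, where both cancel. *)
Lemma clique_weq0 L u : clique L -> {subset u <= L} -> parity u =1 xpred0 ->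
  weq u [::].
Proof.
move=> LP; have [n] := ubnP (size u).
elim: n u => // n IHn [|z u] /= un uL u0; first exact: weq_refl.
have zu : z \in u.
  by apply: parity_mem; have := u0 z; rewrite parity_cons eqxx; case: parity.
have: z \notin take (index z u) u.
  by apply/negP => /index_ltn; rewrite ltnn.
have := cat_take_drop (index z u) u; rewrite drop_index //.
set v := take _ _; set w := drop _ _ => uE zv.
have uLE t : t \in u -> t \in L by move=> tu; apply: uL; rewrite inE tu orbT.
apply: (@weq_trans _ (v ++ w)).
  rewrite -uE; apply: (@weq_trans _ (rcons v z ++ z :: w)).
    apply: (weq_catr (z :: w) (u := z :: v)); apply: weq_push => t tv.
    apply: LP; rewrite ?uL ?mem_head //.
      by rewrite inE -uE mem_cat tv orbT.
    by apply: contraNneq zv => ->.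
  by rewrite cat_rcons; apply: (weq_cancel v w z).
apply: IHn.
- move: un; rewrite -uE !size_cat /= addnS ltnS => /ltnW; exact: leq_trans.
- move=> t; rewrite mem_cat => tvw; apply: uLE; rewrite -uE mem_cat inE.
  by case/orP: tvw => ->; rewrite ?orbT.
- move=> t; have := u0 t; rewrite -uE !(parity_cons, parity_cat).
  by case: eqP; case: parity; case: parity.
Qed.

(** A clique generates an elementary abelian 2-group, on which parity is
faithful. *)
Lemma clique_weq L u v : clique L -> {subset u <= L} -> {subset v <= L} ->
  parity u =1 parity v -> weq u v.
Proof.
move=> LP uL vL uv; apply: weq_revP; apply: (clique_weq0 LP) => [t|t].
  by rewrite mem_cat mem_rev => /orP[/uL|/vL].
by rewrite parity_cat parity_rev uv addbb.
Qed.

End RightAngledCoxeterGroup.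

(** * The Davis complex *)
Section DavisComplex.
Variables (Z : choiceType) (com : rel Z).
Hypothesis com_sym : symmetric com.
Implicit Types (z t : Z) (u v w L : seq Z).
Let weq := weq com.
Let clique := clique com.

Let weqb u v := `[< weq u v >].

Lemma weqb_refl : reflexive weqb.
Proof. by move=> u; apply/asboolP/weq_refl. Qed.

Lemma weqb_sym : symmetric weqb.
Proof. by move=> u v; apply/asboolP/asboolP => /weq_sym. Qed.

Lemma weqb_trans : transitive weqb.
Proof.
by move=> u v w /asboolP vu /asboolP uw; apply/asboolP/(weq_trans vu).
Qed.

Canonical weq_equiv := EquivRel weqb weqb_refl weqb_sym weqb_trans.

Definition racg := {eq_quot weq_equiv}%qT.
Implicit Types (x y : racg).

Definition elt u : racg := (\pi_racg u)%qT.

Lemma eltP u v : elt u = elt v <-> weq u v.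
Proof. by split=> [/eqmodP/asboolP|uv] //; apply/eqmodP/asboolP. Qed.

Definition rmulw x u : racg := elt (repr x ++ u).

Lemma elt_repr x : elt (repr x) = x.
Proof. exact: reprK. Qed.

Lemma weq_repr u : weq (repr (elt u)) u.
Proof. by apply/eltP; rewrite elt_repr. Qed.

Lemma rmulw_elt u v : rmulw (elt u) v = elt (u ++ v).
Proof. by apply/eltP/weq_catr/weq_repr. Qed.

Lemma rmulw0 x : rmulw x [::] = x.
Proof. by rewrite /rmulw cats0 elt_repr. Qed.

Lemma rmulw_cat x u v : rmulw x (u ++ v) = rmulw (rmulw x u) v.
Proof.
by rewrite -[RHS]/(rmulw (elt (repr x ++ u)) v) rmulw_elt /rmulw catA.
Qed.

Lemma rmulwP x u v : rmulw x u = rmulw x v <-> weq u v.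
Proof.
by split=> [/eltP/weq_cancell//|uv]; apply/eltP; apply: weq_catl.
Qed.

Lemma rmulw_revK x u : rmulw (rmulw x u) (rev u) = x.
Proof. by rewrite -rmulw_cat -{2}[x]rmulw0; apply/rmulwP/weq_catrevK. Qed.

Lemma rmulw1_inj x z t : rmulw x [:: z] = rmulw x [:: t] -> z = t.
Proof.
by move/rmulwP/weq_parity/(_ t); rewrite !parity1 eqxx => /eqP.
Qed.

Lemma rmulw1_neq x z : rmulw x [:: z] <> x.
Proof.
by rewrite -{2}[x]rmulw0 => /rmulwP/weq_parity/(_ z); rewrite parity1 eqxx.
Qed.

Definition coset x L : set racg :=
  [set y | exists2 u, {subset u <= L} & y = rmulw x u].

Lemma coset_refl x L : coset x L x.
Proof. by exists [::] => //; rewrite rmulw0. Qed.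

Lemma sub_coset x L L' : {subset L <= L'} -> coset x L `<=` coset x L'.
Proof. by move=> LL' y [u uL ->]; exists u => // z /uL/LL'. Qed.

Lemma eq_coset x L L' : L =i L' -> coset x L = coset x L'.
Proof.
by move=> LL'; apply/seteqP; split; apply: sub_coset => z; rewrite LL'.
Qed.

Lemma coset_trans x y y' L : coset x L y -> coset y L y' -> coset x L y'.
Proof.
move=> [u uL ->] [v vL ->]; exists (u ++ v); last by rewrite rmulw_cat.
by move=> t; rewrite mem_cat => /orP[/uL|/vL].
Qed.

Lemma coset_sym x y L : coset x L y -> coset y L x.
Proof.
move=> [u uL ->]; exists (rev u); last by rewrite rmulw_revK.
by move=> t; rewrite mem_rev => /uL.
Qed.

Lemma coset_eq x y L : coset x L y -> coset x L = coset y L.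
Proof.
move=> xy; apply/seteqP; split=> z; first exact/coset_trans/coset_sym.
exact: coset_trans.
Qed.

Lemma coset_rmulw1 x z L : coset x L (rmulw x [:: z]) <-> z \in L.
Proof.
split=> [[u uL] /rmulwP/weq_parity/(_ z)|zL].
  by rewrite parity1 eqxx => /esym/parity_mem/uL.
by exists [:: z] => // t; rewrite inE => /eqP->.
Qed.

Definition davis_cube : set (set racg) :=
  [set s | exists x L, clique L /\ s = coset x L].

Lemma coset0 x : coset x [::] = [set x].
Proof.
apply/seteqP; split=> [y [[|z u] uL ->]|y ->]; last exact: coset_refl.
  by rewrite rmulw0.
by have := uL z (mem_head _ _).
Qed.

Lemma coset1 x z : coset x [:: z] = [set x; rmulw x [:: z]].
Proof.
apply/seteqP; split=> [y [u uL ->]|y [|] ->]; last 2 first.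
- exact: coset_refl.
- by apply/coset_rmulw1; rewrite mem_head.
have cz : clique [:: z].
  by move=> a b; rewrite !inE => /eqP-> /eqP->; rewrite eqxx.
have uz a : a \in u -> a = z by move/uL; rewrite inE => /eqP.
case zu: (parity u z); [right|left; rewrite /= -{2}[x]rmulw0];
  apply/rmulwP/(clique_weq cz) => // a; rewrite ?parity1.
  by case: eqP => [<-//|za]; apply/negP => /parity_mem/uz/esym.
by apply/negP => pa; move: zu; rewrite -{1}(uz a) ?pa // parity_mem.
Qed.

Lemma davis_cube_vertex x : davis_cube [set x].
Proof. by exists x, [::]; rewrite coset0. Qed.

(** A common point is reached by two words with the same parity, so that its
odd letters lie in both sets; since [L] is a clique, they suffice to write
it. *)
Lemma cosetI x L L' : clique L ->
  coset x L `&` coset x L' = coset x [seq z <- L | z \in L'].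
Proof.
move=> LP; apply/seteqP; split=> [y [[u uL ->] [v vL /rmulwP/weq_parity uv]]|].
  exists [seq z <- undup L | parity u z].
    move=> z; rewrite !mem_filter mem_undup uv => /andP[/parity_mem/vL-> ->].
    by [].
  apply/rmulwP/(clique_weq LP) => // [z|z].
    by rewrite mem_filter mem_undup => /andP[].
  rewrite [RHS]parity_uniq ?filter_uniq ?undup_uniq // mem_filter mem_undup.
  by case E: (parity u z) => //=; rewrite uL ?parity_mem.
move=> y [u uLL ->]; split; exists u => // z /uLL;
  by rewrite mem_filter => /andP[].
Qed.

Lemma davis_cubeI (s t : set racg) : davis_cube s -> davis_cube t ->
  s `&` t !=set0 -> davis_cube (s `&` t).
Proof.
move=> [x [L [LP ->]]] [y [L' [LP' ->]]] [z [/coset_eq-> /coset_eq->]].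
exists z, [seq a <- L | a \in L']; split; last exact: cosetI.
by apply: clique_sub LP => a; rewrite mem_filter => /andP[].
Qed.

(** The coordinate of index i of a vertex of the cube is the parity of the
letter [f i] in a word leading to it from [x]. *)
Section Chart.
Variables (x : racg) (n : nat) (f : 'I_n -> Z).
Hypothesis f_inj : injective f.

Definition chart_word (e : {ffun 'I_n -> bool}) : seq Z :=
  [seq f i | i <- enum 'I_n & e i].

Definition chart e : racg := rmulw x (chart_word e).

Lemma chart_word_uniq e : uniq (chart_word e).
Proof. by rewrite map_inj_uniq // filter_uniq // enum_uniq. Qed.

Lemma parity_chart e i : parity (chart_word e) (f i) = e i.
Proof.
rewrite parity_uniq ?chart_word_uniq // mem_map // mem_filter mem_enum.
by rewrite andbT.
Qed.

Lemma chart_inj : injective chart.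
Proof.
move=> e e' /rmulwP/weq_parity ee'.
by apply/ffunP => i; rewrite -!parity_chart ee'.
Qed.

Hypothesis f_clique : clique (codom f).

Lemma chart_rmulw e w : {subset w <= codom f} ->
  rmulw (chart e) w = chart [ffun i => e i (+) parity w (f i)].
Proof.
move=> wf; have sub e' : {subset chart_word e' <= codom f}.
  by move=> z /mapP[i _ ->]; apply: codom_f.
rewrite /chart -rmulw_cat; apply/rmulwP/(clique_weq f_clique) => // [z|z].
  by rewrite mem_cat => /orP[/sub|/wf].
case: (boolP (z \in codom f)) => [/codomP[i ->]|zf].
  by rewrite parity_cat !parity_chart ffunE.
have no v : {subset v <= codom f} -> parity v z = false.
  by move=> vf; apply: contraNF zf => /parity_mem/vf.
by rewrite parity_cat !no.
Qed.

(** Faces of a cube are the cosets of subsets of its clique: fixing a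
coordinate amounts to forbidding a letter. *)
Lemma face_coset (e : {ffun 'I_n -> bool}) (D : pred 'I_n) :
  chart @` [set e' : {ffun 'I_n -> bool} | forall i, ~~ D i -> e' i = e i] =
  coset (chart e) [seq f i | i in D].
Proof.
have sub w : {subset w <= [seq f i | i in D]} -> {subset w <= codom f}.
  by move=> wD z /wD /mapP[i _ ->]; apply: codom_f.
apply/seteqP; split=> [y [e' e'e <-]|y [w wD ->]].
  exists (chart_word [ffun i => e i (+) e' i]); last first.
    rewrite chart_rmulw; last by move=> z /mapP[i _ ->]; apply: codom_f.
    by congr chart; apply/ffunP => i; rewrite ffunE parity_chart ffunE addKb.
  move=> z /mapP[i]; rewrite mem_filter ffunE => /andP[ei _] ->.
  apply: map_f; rewrite mem_enum; apply/negPn/negP => /e'e ei'.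
  by rewrite ei' addbb in ei.
exists [ffun i => e i (+) parity w (f i)]; last first.
  by rewrite chart_rmulw //; apply: sub.
move=> i Di; rewrite ffunE; case: (boolP (parity _ _)); last by rewrite addbF.
by move=> /parity_mem/wD; rewrite mem_map // mem_enum => /(negP Di).
Qed.

End Chart.

Lemma cube_face_pattern n (p : 'I_n -> option bool) :
  cube_face p = [set e : {ffun 'I_n -> bool} | forall i, ~~ (p i == None) ->
                   e i = [ffun i => odflt false (p i)] i].
Proof.
apply/seteqP; split=> e /= ep i.
  by case Ei: (p i) => [b|//] _; rewrite ffunE Ei; apply: ep.
by move=> b pi; rewrite ep ?pi // ffunE pi.
Qed.

Lemma coset_range x L : clique L -> uniq L ->
  coset x L = range (chart x (tnth (in_tuple L))).
Proof.
move=> LP L_uniq; set f := tnth _.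
have f_inj : injective f by apply/tuple_uniqP.
have fL : codom f = L by rewrite /codom /image_mem map_tnth_enum.
have fP : clique (codom f) by rewrite fL.
have x0 : x = chart x f [ffun=> false].
  rewrite /chart /chart_word (eq_filter (a2 := pred0)) => [|i].
    by rewrite filter_pred0 rmulw0.
  by rewrite ffunE.
transitivity (coset x (codom f)); first by rewrite fL.
rewrite {1}x0 -[codom f]/[seq f i | i in predT] -face_coset //.
by congr image; apply/seteqP; split.
Qed.

Lemma davis_cubeP s : davis_cube s ->
  exists n (c : {ffun 'I_n -> bool} -> racg), cube_chart davis_cube c s.
Proof.
move=> [x [L0 [L0P ->]]]; pose L := undup L0.
have -> : coset x L0 = coset x L by apply: eq_coset => z; rewrite mem_undup.
have LP : clique L by apply: clique_sub L0P => z; rewrite mem_undup.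
pose f := tnth (in_tuple L).
have f_inj : injective f by apply/tuple_uniqP/undup_uniq.
have fL : codom f = L by rewrite /codom /image_mem map_tnth_enum.
have fP : clique (codom f) by rewrite fL.
have sE : coset x L = range (chart x f) by apply/coset_range/undup_uniq.
exists (size L), (chart x f); split=> [||t tL]; [exact: chart_inj|exact: sE|].
split=> [[y [L' [LP' tE]]]|[p ->]]; last first.
  rewrite cube_face_pattern face_coset //.
  eexists; eexists; split; last reflexivity.
  by apply: clique_sub fP => z /mapP[i _ ->]; apply: codom_f.
have yL : coset x L y by apply: tL; rewrite tE; apply: coset_refl.
have L'L : {subset L' <= L}.
  move=> z zL'; apply/(coset_rmulw1 y); rewrite -(coset_eq yL); apply: tL.
  by rewrite tE; apply/coset_rmulw1.
move: yL; rewrite sE => -[e0 _ e0y].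
(* The face through e0 on which only the letters of L' are free. *)
exists (fun i => if f i \in L' then None else Some (e0 i)).
rewrite cube_face_pattern tE -e0y.
transitivity (coset (chart x f e0) [seq f i | i in [pred i | f i \in L']]).
  apply: eq_coset => z; apply/idP/mapP => [zL'|[i]]; last first.
    by rewrite mem_enum inE => + ->.
  have /codomP[i zi] : z \in codom f by rewrite fL L'L.
  exists i => //.
  by rewrite mem_enum inE -zi.
rewrite -face_coset //; congr image; apply/seteqP; split=> e /= eP i iL'.
  by rewrite ffunE eP; case: ifP iL' => //= ->.
by rewrite eP ?ffunE ?(negPf iL').
Qed.

Definition davis : cubeComplex :=
  CubeComplex davis_cube_vertex davis_cubeP davis_cubeI.

Lemma davis_cube_coset (s : set racg) x : davis_cube s -> s x ->
  exists2 L, clique L & s = coset x L.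
Proof. by move=> [y [L [LP ->]]] /coset_eq->; exists L. Qed.

Lemma clique1 z : clique [:: z].
Proof. by move=> a b; rewrite !inE => /eqP-> /eqP->; rewrite eqxx. Qed.

Lemma davis_adjacentP (x y : davis) :
  adjacent x y <-> exists z, y = rmulw x [:: z].
Proof.
split=> [[xy cxy]|[z ->]].
  have [L LP sE] := davis_cube_coset cxy (or_introl erefl).
  have [u uL yE] : coset x L y by rewrite -sE; right.
  case: (pselect (exists z, parity u z)) => [[z /parity_mem/uL zL]|no].
    exists z; have : coset x L (rmulw x [:: z]) by apply/coset_rmulw1.
    by rewrite -sE => -[/rmulw1_neq//|].
  case: xy; rewrite yE -{1}[x]rmulw0; apply/rmulwP/(clique_weq LP) => // z.
  by apply/esym/negP => uz; apply: no; exists z.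
split; first by apply/nesym/rmulw1_neq.
by exists x, [:: z]; rewrite coset1; split=> //; apply: clique1.
Qed.

(** The link of every vertex is the clique complex of the commutation graph,
which is flag. *)
Lemma davis_link_simplexP (x : davis) (s : set davis) :
  link_simplex x s <->
  exists2 L, clique L & s = [set rmulw x [:: z] | z in [set` L]].
Proof.
have linkE L : [set w : davis | coset x L w /\ adjacent x w] =
    [set rmulw x [:: z] | z in [set` L]].
  apply/seteqP; split=> [w [Lw /davis_adjacentP[z wz]]|w [z zL <-]].
    by exists z => //; move: Lw; rewrite wz => /coset_rmulw1.
  by split; [apply/coset_rmulw1|apply/davis_adjacentP; exists z].
split=> [[t tc [tx ->]]|[L LP ->]].
  by have [L LP ->] := davis_cube_coset tc tx; exists L.
exists (coset x L); first by exists x, L.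
by split; [apply: coset_refl|rewrite linkE].
Qed.

Lemma davis_flag_link (x : davis) : flag_link x.
Proof.
move=> s s_fin sP; apply/davis_link_simplexP.
have [L LE] : exists L, [set z | s (rmulw x [:: z])] = [set` L].
  apply/finite_seqP; apply: finite_preimage s_fin => z t _ _.
  exact: rmulw1_inj.
have inL z : z \in L <-> s (rmulw x [:: z]).
  by have /seteqP[LE1 LE2] := LE; split; [apply: LE2|apply: LE1].
exists L => [y z /inL sy /inL sz yz|].
  have /davis_link_simplexP[L' L'P /seteqP[sub _]] := sP _ _ sy sz.
  have [y' y'L' /rmulw1_inj yy'] := sub _ (or_introl erefl).
  have [z' z'L' /rmulw1_inj zz'] := sub _ (or_intror erefl).
  by move: yz; rewrite -yy' -zz'; apply: L'P.
apply/seteqP; split=> [w sw|w [z zL <-]]; last exact/inL.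
have /davis_link_simplexP[L' _ /seteqP[sub _]] := sP _ _ sw sw.
have [z _ zw] := sub _ (or_introl erefl); exists z => //.
by apply/inL; rewrite zw.
Qed.

Fixpoint walk x u : seq davis :=
  if u is z :: v then rmulw x [:: z] :: walk (rmulw x [:: z]) v else [::].

Lemma walk_cat x u v : walk x (u ++ v) = walk x u ++ walk (rmulw x u) v.
Proof.
elim: u x => [|z u IHu] x /=; first by rewrite rmulw0.
by rewrite IHu -rmulw_cat.
Qed.

Lemma last_walk x u : last x (walk x u) = rmulw x u.
Proof.
by elim: u x => [|z u IHu] x /=; rewrite ?rmulw0 // IHu -rmulw_cat.
Qed.

Lemma size_walk x u : size (walk x u) = size u.
Proof. by elim: u x => //= z u IHu x; rewrite IHu. Qed.

Lemma edge_path_walk x u : edge_path (X := davis) x (walk x u).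
Proof.
elim: u x => //= z u IHu x; split=> //.
by apply/davis_adjacentP; exists z.
Qed.

Lemma edge_pathP (x : davis) (p : seq davis) :
  edge_path x p -> exists u, p = walk x u.
Proof.
elim: p x => [|y p IHp] x /=; first by exists [::].
move=> [/davis_adjacentP[z ->] /IHp[u ->]]; by exists (z :: u).
Qed.

Lemma davis_square (x : davis) (y z : Z) : y != z -> com y z ->
  square x (rmulw x [:: y]) (rmulw x [:: y; z]) (rmulw x [:: z]).
Proof.
move=> yz cyz; have LP : clique [:: y; z].
  move=> a b; rewrite !inE => /orP[]/eqP-> /orP[]/eqP->; rewrite ?eqxx //.
  by rewrite com_sym.
have swap : rmulw x [:: y; z] = rmulw x [:: z; y].
  exact/rmulwP/(weq_swap [::] [::]).
have adj u t : adjacent (X := davis) (rmulw x u) (rmulw x (rcons u t)).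
  by apply/davis_adjacentP; exists t; rewrite -cats1 rmulw_cat.
have adjC (v w : davis) : adjacent v w -> adjacent w v.
  by move=> [vw cvw]; split; [apply: nesym|rewrite setUC].
split.
- split; first by have := adj [::] y; rewrite rmulw0.
  + exact: (adj [:: y]).
  + by rewrite swap; apply/adjC/(adj [:: z]).
  + by apply: adjC; have := adj [::] z; rewrite rmulw0.
- rewrite -{1}[x]rmulw0 => /rmulwP/weq_parity/(_ y).
  by rewrite !parity_cons eqxx eq_sym (negPf yz).
- by move/rmulw1_inj/eqP; apply/negP.
exists x, [:: y; z]; split=> //.
apply/seteqP; split=> v.
  case=> ->; first exact: coset_refl;
    [exists [:: y]|exists [:: y; z]|exists [:: z]] => // t.
    by rewrite !inE => ->.
  by rewrite !inE => ->; rewrite orbT.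
move=> [u uL ->].
(* Among the four words in y and z, w is the one with the parity of u. *)
pose w := (if parity u y then [:: y] else [::]) ++
  (if parity u z then [:: z] else [::]).
have -> : rmulw x u = rmulw x w.
  apply/rmulwP/(clique_weq LP) => // [t|t].
    rewrite /w; case: ifP; case: ifP => _ _; rewrite !inE //= ?orbF => ->;
      by rewrite ?orbT.
  have bit (b : bool) a : parity (if b then [:: a] else [::]) t = b && (a == t).
    by case: b; rewrite ?parity1.
  rewrite parity_cat !bit; case: (eqVneq y t) => [<-|yt].
    by rewrite eq_sym (negPf yz) andbT andbF addbF.
  case: (eqVneq z t) => [<-|zt]; first by rewrite andbF andbT.
  rewrite !andbF; apply/negP => /parity_mem/uL.
  by rewrite !inE eq_sym (negPf yt) eq_sym (negPf zt).
rewrite /w; case: ifP; case: ifP => _ _ /=.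
- exact: Or43.
- exact: Or42.
- exact: Or44.
- by rewrite rmulw0; apply: Or41.
Qed.

(** Each move on words is a backtrack or a square of the complex, except the
swap of two equal letters, which does nothing. *)
Lemma weq_edge_homotopic (x : davis) u v : weq u v ->
  edge_homotopic (x :: walk x u) (x :: walk x v).
Proof.
have splitE u' v' : x :: walk x (u' ++ v') =
    belast x (walk x u') ++ [:: rmulw x u'] ++ walk (rmulw x u') v'.
  by rewrite walk_cat -cat_cons lastI last_walk cat_rcons.
elim=> {u v} [u|u v _|u v w _ + _|u v z|u v y z cyz].
- exact: edge_homotopic_refl.
- exact: edge_homotopic_sym.
- exact: edge_homotopic_trans.
- rewrite !splitE /=.
  have -> : rmulw (rmulw (rmulw x u) [:: z]) [:: z] = rmulw x u.
    rewrite -!rmulw_cat; apply/rmulwP.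
    by have := weq_cancel com u [::] z; rewrite !cats0.
  apply: edge_homotopic_backtrack.
  by apply/davis_adjacentP; exists z.
have [->|yz] := eqVneq y z; first exact: edge_homotopic_refl.
rewrite !splitE /= -!(rmulw_cat (rmulw x u)).
have -> : rmulw (rmulw x u) ([:: z] ++ [:: y]) =
    rmulw (rmulw x u) ([:: y] ++ [:: z]).
  by apply/rmulwP/(weq_swap [::] [::]); rewrite com_sym.
exact/edge_homotopic_square/davis_square.
Qed.

Lemma davis_simply_connected : simply_connected davis.
Proof.
split; first exact: (inhabits (elt [::])).
  move=> x y; exists (walk x (rev (repr x) ++ repr y)).
    exact: edge_path_walk.
  rewrite last_walk -{1}[x]elt_repr rmulw_elt -{2}[y]elt_repr.
  apply/eltP; rewrite catA; apply: (weq_catr _ (weq_catrevK _ _)).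
move=> x p /edge_pathP[u ->]; rewrite last_walk -{2}[x]rmulw0 => /rmulwP.
exact: weq_edge_homotopic.
Qed.

Lemma davis_CAT0 : CAT0 davis.
Proof. by split; [exact: davis_simply_connected|exact: davis_flag_link]. Qed.


(** A cube spanned by a clique has 2 ^ k vertices for a clique of size k, which
bounds the dimension of each of its charts. *)
Lemma davis_finite_dimensional d :
  (forall L, uniq L -> clique L -> size L <= d) -> finite_dimensional davis.
Proof.
move=> Ld; exists d => n c s [x [L0 [LP sE]]] [c_inj sc _].
pose L := undup L0; apply: (@leq_trans (size L)); last first.
  apply: Ld; first exact: undup_uniq.
  by apply: clique_sub LP => z; rewrite mem_undup.
have Lx e : exists e', c e = chart x (tnth (in_tuple L)) e'.
  have : range (chart x (tnth (in_tuple L))) (c e).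
    rewrite -coset_range ?undup_uniq //; last first.
      by apply: clique_sub LP => z; rewrite mem_undup.
    rewrite (@eq_coset _ _ L0) => [|z]; last by rewrite mem_undup.
    by rewrite -sE sc; exists e.
  by case=> e' _ <-; exists e'.
have [g gP] := choice Lx.
have g_inj : injective g by move=> e e' ee'; apply: c_inj; rewrite !gP ee'.
have := leq_card g g_inj; rewrite !card_ffun card_bool !card_ord.
by rewrite leq_exp2l.
Qed.

(** * Affine actions on the Davis complex *)

Lemma weq_map (f : Z -> Z) u v : {homo f : y z / com y z} ->
  weq u v -> weq (map f u) (map f v).
Proof.
move=> fcom; elim=> {u v} [u|u v _|u v w _ + _|u v z|u v y z yz].
- exact: weq_refl.
- exact: weq_sym.
- exact: weq_trans.
- by rewrite !map_cat; apply: weq_cancel.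
- by rewrite !map_cat; apply: weq_swap; apply: fcom.
Qed.

(** The group [G] acts on words through [sigma], and [kappa] is a cocycle for
this action; they combine into an action by left translations and
automorphisms. *)
Section AffineAction.
Variables (G : groupType) (sigma : G -> Z -> Z) (kappa : G -> seq Z).
Hypotheses (sigma1 : sigma 1 =1 id)
  (sigmaM : forall g h z, sigma (g * h) z = sigma g (sigma h z))
  (sigma_com : forall g, {homo sigma g : y z / com y z})
  (kappa1 : weq (kappa 1) [::])
  (kappaM : forall g h,
    weq (kappa (g * h)) (kappa g ++ map (sigma g) (kappa h))).

Definition affine g (x : davis) : davis :=
  elt (kappa g ++ map (sigma g) (repr x)).

Lemma affine_elt g u : affine g (elt u) = elt (kappa g ++ map (sigma g) u).
Proof. by apply/eltP/weq_catl/weq_map => //; apply: weq_repr. Qed.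

Lemma affine_rmulw g x u :
  affine g (rmulw x u) = rmulw (affine g x) (map (sigma g) u).
Proof.
by rewrite -{1}[x]elt_repr rmulw_elt affine_elt /affine rmulw_elt map_cat catA.
Qed.

Lemma affine1 x : affine 1 x = x.
Proof.
rewrite -{2}[x]elt_repr; apply/eltP; rewrite (eq_map sigma1) map_id.
exact: (weq_catr _ kappa1).
Qed.

Lemma affineM g h x : affine (g * h) x = affine g (affine h x).
Proof.
rewrite affine_elt; apply/eltP; rewrite map_cat catA -map_comp.
rewrite (eq_map (g := sigma g \o sigma h)).
  exact: (weq_catr _ (kappaM g h)).
exact: sigmaM.
Qed.

Lemma affine_cube g (s : set davis) : cube s -> cube (affine g @` s).
Proof.
move=> [x [L [LP ->]]]; exists (affine g x), (map (sigma g) L); split.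
  move=> _ _ /mapP[y yL ->] /mapP[z zL ->] yz.
  apply: sigma_com; apply: LP => //.
  by apply: contraNN yz => /eqP->.
have sub x' L' h :
    affine h @` coset x' L' `<=` coset (affine h x') (map (sigma h) L').
  move=> _ [_ [u uL ->] <-]; exists (map (sigma h) u); last exact: affine_rmulw.
  by move=> _ /mapP[z /uL zL ->]; apply: map_f.
apply/seteqP; split=> [|y yL]; first exact: sub.
exists (affine g^-1 y); last by rewrite -affineM mulgV affine1.
have := sub _ _ g^-1 _ (ex_intro2 _ _ y yL erefl).
rewrite -affineM mulVg affine1 -map_comp (eq_map (g := id)) ?map_id // => z /=.
by rewrite -sigmaM mulVg sigma1.
Qed.

Definition affine_action : cube_action G davis :=
  @CubeAction G davis affine affine1 affineM affine_cube.

(** An edge path from the identity to the element represented by [kappa g]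
spells a word for that element, which contains all the odd letters. *)
Lemma bounded_affine_orbit : bounded_orbit affine_action (elt [::]) ->
  exists N, forall g, exists2 K : seq Z, size K <= N &
    forall z, parity (kappa g) z -> z \in K.
Proof.
move=> [N NP]; exists N => g; have [p [/edge_pathP[u ->] + uN]] := NP g.
rewrite last_walk /= affine_elt rmulw_elt cats0 => /eltP/weq_parity uP.
by exists u => [|z]; rewrite -?uP -?(size_walk (elt [::])) //; apply: parity_mem.
Qed.

Lemma FW_fin_bounded_cocycle d : FW_fin G ->
  (forall L, uniq L -> clique L -> size L <= d) ->
  exists N, forall g, exists2 K : seq Z, size K <= N &
    forall z, parity (kappa g) z -> z \in K.
Proof.
move=> G_FW Ld; apply: bounded_affine_orbit; apply: contrapT => unbounded.
apply: G_FW; exists davis, affine_action, (elt [::]); split=> //.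
- exact: davis_finite_dimensional Ld.
- exact: davis_CAT0.
Qed.

End AffineAction.
End DavisComplex.

(** * Boundedly commensurated subsets *)
Section AlmostInvariant.
Variable Z : choiceType.
Implicit Types (D E K R : {fset Z}) (F : set {fset Z}).

(** The limit is a set of largest cardinality contained in infinitely many
members of [F]: by maximality, only finitely many of those contain a given
further point. *)
Lemma infinite_family_limit F n : infinite_set F ->
    (forall D, F D -> #|` D| <= n) ->
  exists E, forall K, exists D,
    [/\ F D, D <> E & forall z, z \in K -> (z \in D) = (z \in E)].
Proof.
move=> F_inf Fn.
pose above E := F `&` [set D | (E `<=` D)%fset].
pose P k := `[< exists2 E, #|` E| = k & infinite_set (above E) >].
have P0 : exists k, P k.
  exists 0; apply/asboolP; exists fset0; first exact: cardfs0.
  by apply: contra_not F_inf; apply: sub_finite_set => D FD; split=> //=.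
have Pn k : P k -> k <= n.
  move=> /asboolP[E <- E_inf]; have [D [FD ED]] : above E !=set0.
    by apply/set0P/negP => /eqP E0; apply: E_inf; rewrite E0.
  exact: leq_trans (fsubset_leq_card ED) (Fn _ FD).
case: (ex_maxnP P0 Pn) => k /asboolP[E <- E_inf] E_max.
exists E => K; apply: contrapT => noD; apply: E_inf.
pose B := [set` K] `\` [set` E].
apply: (@sub_finite_set _ _ ([set E] `|` \bigcup_(k in B) above (k |` E)%fset)).
  move=> D [FD ED]; have [->|DE] := pselect (D = E); first by left.
  right; apply: contrapT => noB; apply: noD; exists D; split=> // z zK.
  case: (boolP (z \in E)) => [/(fsubsetP ED)//|zE].
  apply/negP => zD; apply: noB; exists z; first by split=> //; apply/negP.
  by split=> //=; rewrite fsubUset fsub1set zD.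
rewrite finite_setU; split=> //; apply: bigcup_finite.
  by apply: finite_setD; apply: finite_fset.
move=> z [_ /negP zE]; apply: contrapT => z_inf.
have /E_max : P #|` (z |` E)%fset| by apply/asboolP; exists (z |` E)%fset.
by rewrite cardfsU1 zE ltnn.
Qed.

Variables (G : groupType) (sigma : G -> Z -> Z) (M : pred Z) (N : nat).
Hypotheses (sigma1 : sigma 1 =1 id)
  (sigmaM : forall g h z, sigma (g * h) z = sigma g (sigma h z)).

Let diff g z : bool := M z (+) M (sigma g^-1 z).

Hypothesis diffN : forall g, exists2 K : seq Z, size K <= N &
  forall z, diff g z -> z \in K.

Let sigmaK g : cancel (sigma g) (sigma g^-1).
Proof. by move=> z; rewrite -sigmaM mulVg sigma1. Qed.

Let sigmaVK g : cancel (sigma g^-1) (sigma g).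
Proof. by move=> z; rewrite -sigmaM mulgV sigma1. Qed.

Let diffM g h z : diff (g * h) z = diff g z (+) diff h (sigma g^-1 z).
Proof. by rewrite /diff invgM sigmaM -[RHS]addbA addKb. Qed.

Let diff_fset g : exists2 K, #|` K| <= N & forall z, diff g z -> z \in K.
Proof.
have [K KN KP] := diffN g; exists [fset z in K]%fset => [|z /KP].
  by rewrite card_fseq; apply: leq_trans (size_undup _) KN.
by rewrite inE.
Qed.

(** Subsets at finite distance from [M] are encoded by their symmetric
difference with [M]: if C and C' correspond to [D] and [D'], then
[translate g D D'] says that C' = g C. *)
Definition translate g D D' : Prop :=
  forall z, (z \in D') = diff g z (+) (sigma g^-1 z \in D).

Lemma translateP g D : exists D', translate g D D'.
Proof.
have [K _ KP] := diff_fset g.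
exists [fset z in (K `|` [fset sigma g z | z in D])%fset |
  diff g z (+) (sigma g^-1 z \in D)]%fset.
move=> z; rewrite !inE /= andbC; case E: (_ (+) _) => //=.
case: (boolP (diff g z)) E => [/KP->//|_ /= zD]; apply/orP; right.
by apply/imfsetP; exists (sigma g^-1 z); rewrite //= sigmaVK.
Qed.

Lemma translate1 D : translate 1 D D.
Proof. by move=> z; rewrite /diff invg1 sigma1 addbb. Qed.

Lemma translateM g h D D' D'' :
  translate h D D' -> translate g D' D'' -> translate (g * h) D D''.
Proof. by move=> hD gD z; rewrite gD hD diffM invgM sigmaM addbA. Qed.

Lemma card_translate g D D' : translate g D D' -> #|` D'| <= N + #|` D|.
Proof.
move=> gD; have [K KN KP] := diff_fset g.
apply: (@leq_trans #|` (K `|` [fset sigma g z | z in D])%fset|).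
  apply: fsubset_leq_card; apply/fsubsetP => z; rewrite gD inE.
  case: (boolP (diff g z)) => [/KP->//|_ /= zD]; apply/orP; right.
  by apply/imfsetP; exists (sigma g^-1 z); rewrite //= sigmaVK.
rewrite cardfsU; apply: leq_trans (leq_subr _ _) _.
by apply: leq_add => //; apply: leq_imfset_card.
Qed.

(** The subset C encoded by [D] is a pointwise limit of translates of [M] that
keep at least [r] points of difference with [M] escaping to infinity. *)
Definition limit_diff D r : Prop := forall K, exists h,
  (forall z, z \in K -> diff h z = (z \in D)) /\
  exists2 R, r <= #|` R| & forall z, z \in R -> z \notin K /\ diff h z.

Lemma limit_diff0 : limit_diff fset0 0.
Proof.
move=> K; exists 1; split=> [z _|]; first by rewrite /diff invg1 sigma1 addbb inE.
by exists fset0 => // z; rewrite inE.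
Qed.

Lemma limit_diff_le D r : limit_diff D r -> r <= N.
Proof.
move=> /(_ fset0) [h [_ [R rR RP]]]; have [K KN KP] := diff_fset h.
apply: leq_trans rR (leq_trans _ KN); apply: fsubset_leq_card.
by apply/fsubsetP => z /RP[_ /KP].
Qed.

Lemma limit_diff_translate g D D' r :
  limit_diff D r -> translate g D D' -> limit_diff D' r.
Proof.
move=> Dr gD K; have [E _ EP] := diff_fset g.
(* Outside E, the support of diff g, the escaping points are moved by g
   without being altered. *)
have [h [hD [R rR RP]]] := Dr [fset sigma g^-1 z | z in (K `|` E)%fset]%fset.
exists (g * h); split=> [z zK|].
  rewrite diffM gD hD //; apply/imfsetP; exists z => //=.
  by rewrite inE zK.
exists [fset sigma g z | z in R]%fset.
  by rewrite card_imfset //=; apply: can_inj (sigmaK g).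
move=> _ /imfsetP[z /= /RP[zKE hz] ->].
have : sigma g z \notin (K `|` E)%fset.
  apply: contraNN zKE => zKE; apply/imfsetP; exists (sigma g z) => //=.
  by rewrite sigmaK.
rewrite inE negb_or => /andP[zK zE]; split=> //.
rewrite diffM sigmaK hz; case: (boolP (diff _ _)) => // /EP.
by rewrite (negPf zE).
Qed.

(** Were the orbit infinite, its members would accumulate at some [E] while
differing from it further and further away. The points where they differ from
[E] would escape in addition to the [r] ones that already do. *)
Lemma limit_diff_orbit_finite D r : limit_diff D r ->
    (forall E, ~ limit_diff E r.+1) ->
  finite_set [set D' | exists g, translate g D D'].
Proof.
move=> Dr r_max; apply: contrapT => /infinite_family_limit.
case/(_ (N + #|` D|)%N) => [D' [g] /card_translate//|E EP].
apply: (r_max E) => K.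
(* As D' agrees with E on E, it contains E, hence strictly; the extra point t
   escapes from K along with R. *)
have [D' [[g gD] D'E D'K]] := EP (K `|` E)%fset.
have [h [hD' [R rR RP]]] := limit_diff_translate Dr gD (K `|` E `|` D')%fset.
exists h; split=> [z zK|]; first by rewrite hD' ?D'K // !inE zK.
have [t tD' tE] : exists2 t, t \in D' & t \notin E.
  apply: contrapT => noT; apply: D'E; apply/fsetP => z.
  apply/idP/idP => [zD'|zE]; last by rewrite D'K // inE zE orbT.
  by apply: contrapT => /negP zE; apply: noT; exists z.
exists (t |` R)%fset.
  rewrite cardfsU1 (_ : t \notin R) ?ltnS //.
  by apply/negP => /RP[]; rewrite !inE tD' orbT.
move=> z; rewrite !inE => /orP[/eqP->|/RP[]]; last first.
  by rewrite !inE !negb_or => /andP[/andP[]].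
split; last by rewrite hD' ?inE tD' ?orbT.
by apply: contraNN tE => tK; rewrite -D'K // inE tK.
Qed.

(** The union of the finite orbit provided by a limit with the largest number
of escaping points is invariant and at finite distance from [M]. *)
Lemma almost_invariant : exists M' : set Z,
  (forall g z, M' z -> M' (sigma g z)) /\ finite_set [set z | ~ (M' z <-> M z)].
Proof.
pose P r := `[< exists D, limit_diff D r >].
have P0 : exists r, P r by exists 0; apply/asboolP; exists fset0; apply: limit_diff0.
have PN r : P r -> r <= N by move=> /asboolP[D]; apply: limit_diff_le.
case: (ex_maxnP P0 PN) => r /asboolP[D Dr] r_max.
have orb_fin : finite_set [set D' | exists g, translate g D D'].
  apply: limit_diff_orbit_finite Dr _ => E Er.
  by have /r_max : P r.+1 by [apply/asboolP; exists E]; rewrite ltnn.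
exists [set z | exists D' g, translate g D D' /\ M z (+) (z \in D')]; split.
  move=> g z [D' [h [hD zD']]]; have [D'' gD'] := translateP g D'.
  exists D'', (g * h); split; first exact: translateM hD gD'.
  by rewrite gD' /diff sigmaK addbA addKb.
have DD := translate1 D.
apply: sub_finite_set (bigcup_finite orb_fin (fun D' _ => finite_fset D')).
move=> z /= zM; apply: contrapT => noD; apply: zM.
have zD D' g : translate g D D' -> (z \in D') = false.
  by move=> gD; apply/negP => zD'; apply: noD; exists D' => //; exists g.
split=> [[D' [g [gD]]]|Mz]; first by rewrite (zD _ _ gD) addbF.
by exists D, 1; rewrite (zD _ _ DD) addbF.
Qed.

End AlmostInvariant.

(** * The cocycle of lamp paths *)
Lemma weq_subrel (Z : choiceType) (com com' : rel Z) u v :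
  subrel com com' -> weq com u v -> weq com' u v.
Proof.
move=> sub; elim=> {u v} [u|u v _|u v w _ + _|u v z|u v y z yz].
- exact: weq_refl.
- exact: weq_sym.
- exact: weq_trans.
- exact: weq_cancel.
- exact/weq_swap/sub.
Qed.

Section GroupMorphism.
Variables (G H : groupType) (f : {multiplicative G -> H}).

Lemma multiplicative1 : f 1 = 1.
Proof. by apply: (mulgI (f 1)); rewrite -gmulfM !mulg1. Qed.

Lemma multiplicativeV g : f g^-1 = (f g)^-1.
Proof. by apply: (mulgI (f g)); rewrite -gmulfM !mulgV multiplicative1. Qed.

Lemma multiplicative_prod I (s : seq I) (F : I -> G) :
  f (\prod_(i <- s) F i) = \prod_(i <- s) f (F i).
Proof. exact: (big_morph f gmulfM multiplicative1). Qed.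

End GroupMorphism.

Section LampPaths.
Variables A B : groupType.
Let Z : choiceType := (B * A)%type.
Implicit Types (u v : wreath A B) (us vs : seq (wreath A B)) (x : B) (y z : Z)
  (w : seq Z) (S : seq B).

Lemma lampsM u v x : lamps (u * v) x = lamps u x * lamps v ((cursor u)^-1 * x).
Proof. exact: lamps_mul. Qed.

Lemma lampsV u x : lamps u^-1 x = (lamps u (cursor u * x))^-1.
Proof. exact: lamps_inv. Qed.

Lemma lamps1 x : lamps (1 : wreath A B) x = 1.
Proof. exact: lamps_one. Qed.

Lemma cursorM u v : cursor (u * v) = cursor u * cursor v.
Proof. by []. Qed.

(** On graphs of configurations, this is the action of the wreath product on
lamp configurations. *)
Definition lamp_act u z : Z :=
  (cursor u * z.1, lamps u (cursor u * z.1) * z.2).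

Lemma lamp_act1 : lamp_act 1 =1 id.
Proof. by move=> [x a]; rewrite /lamp_act lamps1 !mul1g. Qed.

Lemma lamp_actM u v z : lamp_act (u * v) z = lamp_act u (lamp_act v z).
Proof.
by rewrite /lamp_act lampsM cursorM /= -!mulgA mulKg.
Qed.

Definition apart z y : bool := z.1 != y.1.

(** Invariant under left translation of the sites, unlike a condition on the
quotients x y^-1. *)
Definition near S y z : bool :=
  apart y z && ((y.1^-1 * z.1 \in S) || (z.1^-1 * y.1 \in S)).

Lemma near_sym S : symmetric (near S).
Proof. by move=> y z; rewrite /near /apart eq_sym orbC. Qed.

Lemma lamp_act_apart u : {homo lamp_act u : y z / apart y z}.
Proof. by move=> y z; rewrite /apart /= (inj_eq (mulgI _)). Qed.

Lemma lamp_act_near S u : {homo lamp_act u : y z / near S y z}.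
Proof.
by move=> y z /andP[yz]; rewrite /near lamp_act_apart //= !invgM -!mulgA !mulKg.
Qed.

(** The sites of a clique are distinct, and those other than a first one x lie
in x S or x S^-1. *)
Lemma near_clique S (L : seq Z) : uniq L -> clique (near S) L ->
  size L <= (size S).*2.+1.
Proof.
case: L => [//|z L] L_uniq LP; rewrite [size _]/= ltnS -addnn.
pose N := [seq z.1 * s | s <- S] ++ [seq z.1 * s^-1 | s <- S].
rewrite (_ : (size S + size S)%N = size N); last by rewrite size_cat !size_map.
move: L_uniq; rewrite cons_uniq => /andP[zL L_uniq].
have sub : {subset L <= z :: L} by move=> y yL; rewrite inE yL orbT.
rewrite -(size_map fst); apply: uniq_leq_size => [|_ /mapP[y yL ->]].
  rewrite map_inj_in_uniq // => y y' yL y'L; apply: contraPeq => yy'.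
  have /andP[yy1 _] := LP y y' (sub _ yL) (sub _ y'L) yy'.
  exact/eqP.
have zy : z != y by apply: contraNneq zL => ->.
have /andP[_] := LP z y (mem_head _ _) (sub _ yL) zy.
rewrite mem_cat => /orP[zyS|yzS]; apply/orP; [left|right]; apply/mapP.
  by exists (z.1^-1 * y.1); rewrite ?mulVKg.
by exists (y.1^-1 * z.1); rewrite // invgM invgK mulVKg.
Qed.

Lemma near_subrel S S' : {subset S <= S'} -> subrel (near S) (near S').
Proof.
by move=> SS' y z /andP[yz /orP[] /SS' yzS]; rewrite /near yz yzS ?orbT.
Qed.

(** A derivation uses finitely many commutations. *)
Lemma weq_near (w w' : seq Z) : weq apart w w' -> exists S, weq (near S) w w'.
Proof.
elim=> {w w'} [w|w w' _ [S wS]|w1 w2 w3 _ [S wS] _ [S' wS']|w w' z|w w' y z yz].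
- by exists [::]; apply: weq_refl.
- by exists S; apply: weq_sym.
- exists (S ++ S'); apply: (@weq_trans _ _ _ w2).
    by apply: weq_subrel wS; apply: near_subrel => x; rewrite mem_cat => ->.
  by apply: weq_subrel wS'; apply: near_subrel => x; rewrite mem_cat orbC => ->.
- by exists [::]; apply: weq_cancel.
- by exists [:: y.1^-1 * z.1]; apply: weq_swap; rewrite /near yz mem_head.
Qed.

Lemma weq_near_all (ws : seq (seq Z)) : {in ws, forall w, weq apart w [::]} ->
  exists S, {in ws, forall w, weq (near S) w [::]}.
Proof.
elim: ws => [|w ws IHws] wsP; first by exists [::].
have [S wS] := weq_near (wsP w (mem_head _ _)).
have [|S' wsS'] := IHws.
  by move=> w' w'ws; apply: wsP; rewrite inE w'ws orbT.
exists (S ++ S') => w'; rewrite inE => /orP[/eqP->|/wsS' w'S'].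
  by apply: weq_subrel wS; apply: near_subrel => x; rewrite mem_cat => ->.
by apply: weq_subrel w'S'; apply: near_subrel => x; rewrite mem_cat orbC => ->.
Qed.

Definition fibre x w : seq Z := [seq z <- w | z.1 == x].

Lemma weq_fibre x w : weq apart w (fibre x w ++ [seq z <- w | z.1 != x]).
Proof.
elim: w => [|z w IHw] /=; first exact: weq_refl.
apply: weq_trans (weq_catl [:: z] IHw) _ => /=.
case: eqP => zx /=; first exact: weq_refl.
rewrite -cat_cons -cat_rcons; apply: weq_catr; apply: weq_push => y.
by rewrite mem_filter => /andP[/eqP yx _]; rewrite /apart yx; apply/eqP.
Qed.

(** When distinct sites commute, the group is the direct sum over the sites of
free products of groups of order 2, so that triviality is tested at each
site. *)
Lemma weq_apart_fibres w :
  (forall x, weq apart (fibre x w) [::]) -> weq apart w [::].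
Proof.
have [n] := ubnP (size w); elim: n w => // n IHn [|z w] wn w0.
  exact: weq_refl.
apply: weq_trans (weq_fibre z.1 _) _.
apply: weq_trans (weq_catr _ (w0 z.1)) _ => /=; rewrite eqxx /=.
apply: IHn => [|x].
  move: wn; rewrite ltnS => /(leq_ltn_trans _)->//.
  by rewrite size_filter count_size.
have [->|xz] := eqVneq x z.1.
  rewrite /fibre -filter_predI (eq_filter (a2 := pred0)) ?filter_pred0.
    exact: weq_refl.
  by move=> y /=; rewrite andbN.
have := w0 x; rewrite /fibre /= eq_sym (negPf xz) -filter_predI.
congr (weq apart _ _); apply: eq_filter => y /=.
by case: eqP => // ->; rewrite xz.
Qed.

Definition lamp_word u : seq Z :=
  flatten [seq [:: (x, 1); (x, lamps u x)] | x <- finsupp (lamps u)].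

Lemma weq_pair (z : Z) : weq apart [::] [:: z; z].
Proof. by apply: weq_sym; apply: (weq_cancel apart [::] [::]). Qed.

Lemma weq_fibre_lamp_word u x :
  weq apart (fibre x (lamp_word u)) [:: (x, 1); (x, lamps u x)].
Proof.
have E (s : seq B) : uniq s ->
    fibre x (flatten [seq [:: (x', 1); (x', lamps u x')] | x' <- s]) =
    if x \in s then [:: (x, 1); (x, lamps u x)] else [::].
  elim: s => //= x' s IHs /andP[x's /IHs E]; rewrite /fibre /= -/(fibre _ _) E inE.
  have [<-|xx'] := eqVneq x' x; last by [].
  by rewrite (negPf x's).
rewrite /lamp_word E ?fset_uniq //; case: finsuppP => _; last exact: weq_refl.
exact: weq_pair.
Qed.

Fixpoint lamp_path us : seq Z :=
  if us is u :: vs then lamp_word u ++ map (lamp_act u) (lamp_path vs)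
  else [::].

Lemma lamp_path_cat us vs : lamp_path (us ++ vs) =
  lamp_path us ++ map (lamp_act (\prod_(u <- us) u)) (lamp_path vs).
Proof.
elim: us => [|u us IHus] /=.
  by rewrite big_nil (eq_map lamp_act1) map_id.
rewrite IHus map_cat catA big_cons -map_comp; congr cat.
by apply: eq_map => z; rewrite lamp_actM.
Qed.

Lemma fibre_map u x w :
  fibre x (map (lamp_act u) w) = map (lamp_act u) (fibre ((cursor u)^-1 * x) w).
Proof.
rewrite /fibre filter_map; congr map; apply: eq_filter => z /=.
by rewrite -(inj_eq (mulgI (cursor u)^-1)) mulKg.
Qed.

(** At the site x the word of a product reads (x, 1) (x, a) (x, a) (x, a')
where a is the state left by the first factor and a' that left by the product:
the two middle letters cancel. This is the cocycle identity, and it shows that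
the word depends on the product alone, not on the list of its factors. *)
Lemma weq_fibre_lamp_path us x :
  weq apart (fibre x (lamp_path us))
    [:: (x, 1); (x, lamps (\prod_(u <- us) u) x)].
Proof.
elim: us x => [|u us IHus] x /=; first by rewrite big_nil lamps1; apply: weq_pair.
rewrite /fibre filter_cat -!/(fibre _ _) fibre_map.
have := weq_cat (weq_fibre_lamp_word u x)
  (weq_map (@lamp_act_apart u) (IHus ((cursor u)^-1 * x))).
move/weq_trans; apply; rewrite /= /lamp_act /= mulVKg mulg1 big_cons lampsM.
exact: (weq_cancel apart [:: (x, 1)]).
Qed.

Lemma weq_lamp_path us : \prod_(u <- us) u = 1 -> weq apart (lamp_path us) [::].
Proof.
move=> us1; apply: weq_apart_fibres => x.
apply: weq_trans (weq_fibre_lamp_path _ _) _.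
by rewrite us1 lamps1; apply/weq_sym/weq_pair.
Qed.

(** The odd letters are the points of the symmetric difference of B * {1} and
of its translate. *)
Lemma parity_lamp_path us z : parity (lamp_path us) z =
  (z.2 == 1) (+) ((lamp_act (\prod_(u <- us) u)^-1 z).2 == 1).
Proof.
have -> : parity (lamp_path us) z = parity (fibre z.1 (lamp_path us)) z.
  rewrite /parity /fibre count_filter; congr odd; apply: eq_count => y /=.
  by case: eqP => // ->; rewrite eqxx.
rewrite (weq_parity (weq_fibre_lamp_path _ _)) parity_cons parity1.
case: z => x a; rewrite !xpair_eqE !eqxx /= lampsV; set u := \prod_(u <- us) u.
rewrite mulVKg.
congr addb; first by rewrite eq_sym.
by rewrite -[RHS](inj_eq (mulgI (lamps u x))) mulVKg mulg1 eq_sym.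
Qed.

(** Spelling g in the generators and composing the corresponding lamp paths
gives a well-defined element of the group as soon as the paths of the relators
and of the trivial cancellations are trivial in it. These are finitely many
words, trivial when all distinct sites commute, hence already for a finite
set [S]. *)
Lemma lamp_cocycle (G : groupType) (phi : {multiplicative G -> wreath A B}) :
    finitely_presented G ->
  exists S (kappa : G -> seq Z),
    [/\ weq (near S) (kappa 1) [::],
        forall g h, weq (near S) (kappa (g * h))
          (kappa g ++ map (lamp_act (phi g)) (kappa h))
      & forall g z, parity (kappa g) z =
          (z.2 == 1) (+) ((lamp_act (phi g^-1) z).2 == 1)].
Proof.
move=> [n [gen [rels [gen_surj relsP]]]].
pose path (p : word n) := lamp_path [seq phi (letter_eval gen l) | l <- p].
have prodE (p : word n) :
    \prod_(u <- [seq phi (letter_eval gen l) | l <- p]) u =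
    phi (word_eval gen p).
  by rewrite big_map /word_eval multiplicative_prod.
have eval0 : word_eval gen [::] = 1 by rewrite /word_eval big_nil.
have path_cat p q : path (p ++ q) =
    path p ++ map (lamp_act (phi (word_eval gen p))) (path q).
  by rewrite /path map_cat lamp_path_cat prodE.
pose moves := rels ++ [seq [:: l; (l.1, ~~ l.2)] | l <- enum {: 'I_n * bool}].
have moves1 r : r \in moves -> word_eval gen r = 1.
  move=> rP; rewrite -eval0; apply/relsP.
  have : word_equiv rels ([::] ++ r ++ [::]) ([::] ++ [::]); last by rewrite /= cats0.
  move: rP; rewrite mem_cat => /orP[rP|/mapP[[i e] _ ->]]; first exact: word_relator.
  exact: word_cancel.
have [S SP] : exists S, {in map path moves, forall w, weq (near S) w [::]}.
  apply: weq_near_all => _ /mapP[r rP ->]; apply: weq_lamp_path.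
  by rewrite prodE moves1 // multiplicative1.
have insert p q r : r \in moves ->
    weq (near S) (path (p ++ r ++ q)) (path (p ++ q)).
  move=> rP; rewrite !path_cat map_cat -map_comp (moves1 r rP) multiplicative1.
  apply: weq_catl.
  rewrite (eq_map (g := lamp_act (phi (word_eval gen p)))); last first.
    by move=> z /=; rewrite lamp_act1.
  apply: (weq_catr _ (u' := [::])).
  by apply: (weq_map (v := [::]) (@lamp_act_near _ _)); apply/SP/map_f.
have path_equiv p q : word_equiv rels p q -> weq (near S) (path p) (path q).
  elim=> {p q} [p|p q _|p q r _ + _|p q i e|p q r rP].
  - exact: weq_refl.
  - exact: weq_sym.
  - exact: weq_trans.
  - apply: insert; rewrite mem_cat; apply/orP; right.
    by apply/mapP; exists (i, e); rewrite ?mem_enum.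
  - by apply: insert; rewrite mem_cat rP.
have [rep repP] := choice gen_surj.
exists S, (path \o rep); split=> [|g h|g z] /=.
- by apply: (path_equiv _ [::]); apply/relsP; rewrite repP eval0.
- have := path_cat (rep g) (rep h); rewrite repP => <-.
  by apply/path_equiv/relsP; rewrite /word_eval big_cat -!/(word_eval _ _) !repP.
- by rewrite parity_lamp_path prodE repP multiplicativeV.
Qed.

(** * Invariant configurations *)

(** The sites over which [M] is not the graph of a function are invariant under
left translation by the projection of G, and finite because [M] is almost the
graph of the trivial configuration. *)
Lemma fixed_or_finite (G : groupType) (phi : {multiplicative G -> wreath A B})
    (M : set Z) :
    (forall g z, M z -> M (lamp_act (phi g) z)) ->
    finite_set [set z | ~ (M z <-> z.2 == 1)] ->
  finite_set (@cursor A B @` range phi) \/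
  exists w : wreath A B,
    range phi `<=` [set u ^ w | u in range (@wreath_base A B)].
Proof.
move=> M_inv M_fin.
have M_act g z : M (lamp_act (phi g) z) <-> M z.
  split; last exact: M_inv.
  by move/(M_inv g^-1); rewrite -lamp_actM -gmulfM mulVg multiplicative1 lamp_act1.
pose graph_at x c := forall a, M (x, a) <-> a = c.
have graph_at1 x : ~ (fst @` [set z | ~ (M z <-> z.2 == 1)]) x -> graph_at x 1.
  move=> xP a; have : M (x, a) <-> a == 1.
    by apply: contrapT => xa; apply: xP; exists (x, a).
  by move=> ->; split=> /eqP.
have fst_fin := finite_image fst M_fin.
have [[x0 x0P]|good] := pselect (exists x, ~ exists c, graph_at x c);
  [left|right].
  (* Translating x0 embeds the projection of G in the finite set of bad sites. *)
  pose bad := [set x | ~ exists c, graph_at x c].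
  apply: (@sub_finite_set _ _ ((fun b => b * x0) @^-1` bad)).
    move=> _ [_ [g _ <-] <-] /= [c cP]; apply: x0P.
    exists ((lamps (phi g) (cursor (phi g) * x0))^-1 * c) => a.
    rewrite -(M_act g) /lamp_act /= cP.
    by split=> [<-|->]; rewrite ?mulKg ?mulVKg.
  apply: finite_preimage => [b b' _ _|]; first exact: mulIg.
  apply: sub_finite_set fst_fin => x xP; apply: contrapT => /graph_at1 x1.
  by apply: xP; exists 1.
have graphP x : exists c, graph_at x c.
  by apply: contrapT => xP; apply: good; exists x.
have [c cP] := choice graphP.
have [X XP] := finite_fsetP.1 fst_fin.
(* The set M is the graph of c, which is trivial outside X. *)
pose k : wreath A B := Wreath [fsfun x in X => c x] 1.
have kE x : lamps k x = c x.
  rewrite fsfun_fun; case: ifP => // xX; apply/(cP x).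
  apply/(graph_at1 x) => //; rewrite XP /=; exact/negP/negbT.
exists k^-1 => _ [g _ <-]; exists (wreath_base A (cursor (phi g))).
  by exists (cursor (phi g)).
rewrite conjgE invgK mulgA; apply: (mulIg k); rewrite mulgVK.
apply: wreath_eqP => [x|]; last by rewrite /= mulg1 mul1g.
rewrite !lampsM !kE /= invg1 mul1g fsfun0E mulg1.
apply/esym/(cP x).
have := M_inv g _ ((cP ((cursor (phi g))^-1 * x) _).2 erefl).
by rewrite /lamp_act /= mulVKg.
Qed.

End LampPaths.

Theorem corollary1p7 (A B G : groupType)
    (phi : {multiplicative G -> wreath A B})
    (G_fp : finitely_presented G) (G_FW : FW_fin G) :
  finite_set (@cursor A B @` range phi) \/
  exists w : wreath A B,
    range phi `<=` [set u ^ w | u in range (@wreath_base A B)].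
Proof.
have [S [kappa [kappa1 kappaM kappa_parity]]] := lamp_cocycle phi G_fp.
have act1 : lamp_act (phi 1) =1 id.
  by move=> z; rewrite multiplicative1 lamp_act1.
have actM g h z :
    lamp_act (phi (g * h)) z = lamp_act (phi g) (lamp_act (phi h) z).
  by rewrite gmulfM lamp_actM.
have [N kappaN] := FW_fin_bounded_cocycle (near_sym S) act1 actM
  (fun g => lamp_act_near (phi g)) kappa1 kappaM G_FW (@near_clique _ _ S).
pose M : pred (B * A)%type := fun z => z.2 == 1.
have [g|M' [M'_inv M'_fin]] := almost_invariant (M := M) (N := N)
  (sigma := fun g => lamp_act (phi g)) act1 actM.
  have [K KN KP] := kappaN g; exists K => // z zK; apply: KP.
  by rewrite kappa_parity.
exact: fixed_or_finite M'_inv M'_fin.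
Qed.
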